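(* Let $G$ be a finite connected simple graph with $n$ vertices and $m$ edges, and let $k\ge 1$ be an integer. Then \[\Pi_2(S_k(G))=4^{km}\,\Pi_2(G).\]
   Context: For a graph $H$ and vertex $v$, $d_H(v)$ denotes the degree of $v$ in $H$. The second multiplicative Zagreb index is $\Pi_2(H)=\prod_{uv\in E(H)} d_H(u)d_H(v)$. The $k$-th subdivision graph $S_k(G)$ is the graph obtained from $G$ by inserting $k$ new vertices into each edge of $G$, i.e. each edge $uv$ of $G$ is replaced by a path from $u$ to $v$ with $k$ new internal vertices (distinct for distinct edges). *)

(* Defs.v *)
From mathcomp Require Import all_boot.

Set Implicit Arguments.
Unset Strict Implicit.
Unset Printing Implicit Defensive.

Record sgraph := SGraph {
  svertex :> finType;
  adj : rel svertex;
  adj_sym : symmetric adj;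
  adj_irrefl : irreflexive adj }.

Section Graph.
Variable G : sgraph.

Definition edges : {set {set G}} :=
  [set [set p.1; p.2] | p : G * G & adj p.1 p.2].

Definition degree (v : G) : nat := #|[set u | adj v u]|.

Definition connected : Prop := forall u v : G, connect (@adj G) u v.

(* An edge is a two-element set of vertices, so the inner product is
   [degree u * degree v]; see [prod_edge]. *)
Definition second_mult_zagreb : nat :=
  \prod_(E in edges) \prod_(v in E) degree v.

Lemma prod_edge (u v : G) : adj u v ->
  \prod_(w in [set u; v]) degree w = degree u * degree v.
Proof.
move=> uv; have nuv : u \notin [set v].
  by rewrite inE; apply/eqP=> E; rewrite E adj_irrefl in uv.
by rewrite big_setU1 //= big_set1.
Qed.

(* One orientation of each edge: every edge occurs exactly once as a pair
   (source, target) with the source enumerated first. The choice only fixes the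
   direction in which the new vertices are numbered. *)
Definition arc : finType :=
  {p : G * G | adj p.1 p.2 && (enum_rank p.1 < enum_rank p.2)}.

Definition source (a : arc) : G := (val a).1.
Definition target (a : arc) : G := (val a).2.

Variable k : nat.

Definition subdiv_vertex : finType := (G + arc * 'I_k)%type.

(* The edge carried by [a] becomes the path
   source a, (a, 0), ..., (a, k - 1), target a. *)
Definition subdiv_adj (x y : subdiv_vertex) : bool :=
  let end_adj (w : G) (a : arc) (i : 'I_k) :=
    (w == source a) && (i == 0 :> nat) || (w == target a) && (i.+1 == k) in
  match x, y with
  | inl u, inl v => (k == 0) && adj u v
  | inl w, inr (a, i) => end_adj w a i
  | inr (a, i), inl w => end_adj w a i
  | inr (a, i), inr (b, j) =>
      (a == b) && ((i.+1 == j :> nat) || (j.+1 == i :> nat))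
  end.

Lemma subdiv_adj_sym : symmetric subdiv_adj.
Proof.
move=> [u|[a i]] [v|[b j]] //=; first by rewrite adj_sym.
by rewrite eq_sym orbC.
Qed.

Lemma subdiv_adj_irrefl : irreflexive subdiv_adj.
Proof.
move=> [u|[a i]] /=; first by rewrite adj_irrefl andbF.
by rewrite eqxx orbb gtn_eqF.
Qed.

Definition subdivision : sgraph := SGraph subdiv_adj_sym subdiv_adj_irrefl.

End Graph.

(* Main.v *)
(** Grouping the factors of the second multiplicative Zagreb index by vertex
    turns it into the product of [d(v) ^ d(v)] over all vertices [v].
    Subdividing keeps the degrees of the old vertices, and each of the [k * m]
    new vertices has degree 2, so contributes a factor [2 ^ 2 = 4]. *)
Require Import Defs.
From mathcomp Require Import all_boot.

Set Implicit Arguments.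
Unset Strict Implicit.
Unset Printing Implicit Defensive.

Section Graph.
Variable G : sgraph.
Implicit Types (u v : G) (a b : Defs.arc G).

Lemma adj_neq u v : adj u v -> u != v.
Proof. by apply: contraTneq => ->; rewrite adj_irrefl. Qed.

(** The map sending a neighbour [u] to [[set v; u]] is a bijection onto the edges at [v];
    injectivity uses that a neighbour of [v] differs from [v]. *)
Lemma card_incident_edges v : #|[set E in edges G | v \in E]| = degree v.
Proof.
rewrite /degree -(@card_in_imset _ _ (fun u => [set v; u])); last first.
  move=> u w; rewrite !inE => vu vw /setP/(_ u); rewrite !inE eqxx orbT.
  by rewrite [u == v]eq_sym (negPf (adj_neq vu)) => /esym/eqP.
congr #|pred_of_set _|; apply/setP=> E; rewrite inE.
apply/andP/imsetP => [[/imsetP[[x y] /= xy ->]]|[u vu ->]].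
  rewrite inE in xy; rewrite !inE => /orP[] /eqP->.
    by exists y; first rewrite inE.
  by exists x; [rewrite inE adj_sym | rewrite setUC].
rewrite inE in vu; rewrite !inE eqxx; split=> //.
by apply/imsetP; exists (v, u); first rewrite inE.
Qed.

Lemma second_mult_zagrebE :
  second_mult_zagreb G = \prod_(v : G) degree v ^ degree v.
Proof.
rewrite /second_mult_zagreb (exchange_big_dep xpredT) //=.
apply: eq_bigr => v _; rewrite prod_nat_const; congr (_ ^ _).
by rewrite -card_incident_edges cardsE.
Qed.

Definition arc_edge a : {set G} := [set source a; target a].

Lemma source_neq_target a : source a != target a.
Proof. by have /andP[/adj_neq] := valP a. Qed.

(** Two arcs on one edge could differ only by a swap of their ends, and the two swapped pairs cannot
    both be increasing for [enum_rank]. *)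
Lemma arc_edge_inj : injective arc_edge.
Proof.
move=> [[x y] pa] [[z t] pb] /setP eab; apply: val_inj => /=.
have /andP[/adj_neq /= nxy lxy] := pa; have /andP[_ /= lzt] := pb.
have := eab x; have := eab y; rewrite !inE !eqxx orbT /source /target /=.
move=> /esym/orP[]/eqP ey /esym/orP[]/eqP ex; rewrite ex ey ?eqxx // in nxy *.
by rewrite ex ey ltnNge ltnW in lxy.
Qed.

Lemma arc_edge_imset : arc_edge @: setT = edges G.
Proof.
apply/setP=> E; apply/imsetP/imsetP => [[a _ ->]|[[x y] xy ->]].
  exists (val a) => //; rewrite inE; by have /andP[] := valP a.
rewrite inE /= in xy; rewrite /=.
case: (ltngtP (enum_rank x) (enum_rank y)) => [lt|lt|/val_inj/enum_rank_inj e].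
- have p : adj (x, y).1 (x, y).2 &&
    (enum_rank (x, y).1 < enum_rank (x, y).2) by rewrite /= xy.
  by exists (Sub (x, y) p); first rewrite inE.
- have p : adj (y, x).1 (y, x).2 &&
    (enum_rank (y, x).1 < enum_rank (y, x).2) by rewrite /= adj_sym xy.
  by exists (Sub (y, x) p); [rewrite inE | rewrite setUC].
- by rewrite e adj_irrefl in xy.
Qed.

Lemma card_arc : #|Defs.arc G| = #|edges G|.
Proof. by rewrite -arc_edge_imset card_imset ?cardsT //; apply: arc_edge_inj. Qed.

(** Arcs index the new paths, so this is the form of the degree to compare with the subdivision. *)
Lemma card_incident_arcs v : #|[set a | v \in arc_edge a]| = degree v.
Proof.
rewrite -card_incident_edges -(card_imset _ arc_edge_inj).
congr #|pred_of_set _|; apply/setP=> E; rewrite inE -arc_edge_imset.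
apply/imsetP/andP => [[a va ->]|[/imsetP[a _ ->] va]].
  by rewrite inE in va; split=> //; apply: imset_f.
by exists a; first rewrite inE.
Qed.

(** Each arc at [v] supplies exactly one neighbour: the first new vertex of its path if [v] is the
    source, the last one otherwise. *)
Lemma degree_subdiv_old k v :
  degree (inl v : subdivision G k.+1) = degree v.
Proof.
pose nb a : subdivision G k.+1 :=
  inr (a, if v == source a then ord0 else ord_max).
have nb_inj : injective nb by move=> a b [].
rewrite -card_incident_arcs -(card_imset _ nb_inj).
congr #|pred_of_set _|; apply/setP=> -[w|[a i]]; rewrite !inE.
  by apply/esym/negbTE/imsetP=> -[].
(* As source and target differ, at most one disjunct of the adjacency test can hold, so the test
   collapses to one condition on [i]. *)
transitivity ((v \in arc_edge a) &&
              (i == if v == source a then ord0 else ord_max)).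
  rewrite !inE /= eqSS; have := source_neq_target a.
  case: (v =P source a) => [-> /negPf->|_ _] /=;
    by rewrite ?orbF.
apply/andP/imsetP => [[va /eqP->]|[b]]; first by (exists a; first rewrite inE).
by rewrite inE => vb [-> ->].
Qed.

(** The neighbours are the predecessor and successor on the path of [a], old vertices at its two
    extremes. *)
Lemma degree_subdiv_new k a (i : 'I_k.+1) :
  degree (inr (a, i) : subdivision G k.+1) = 2.
Proof.
pose prv : subdivision G k.+1 :=
  if i == 0 :> nat then inl (source a) else inr (a, inord i.-1).
pose nxt : subdivision G k.+1 :=
  if i == k :> nat then inl (target a) else inr (a, inord i.+1).
have ltpk : i.-1 < k.+1 by rewrite (leq_ltn_trans (leq_pred i)).
have prvE j : (inr (a, j) == prv) = (j.+1 == i :> nat).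
  rewrite /prv; case: (i =P 0 :> nat) => [->|/eqP i0] //.
  apply/eqP/eqP => [[->]|ji]; last by rewrite -ji /= inord_val.
  by rewrite inordK // prednK // lt0n.
have nxtE j : (inr (a, j) == nxt) = (i.+1 == j :> nat).
  rewrite /nxt; case: (i =P k :> nat) => [->|/eqP nik].
    by apply/esym/negbTE; rewrite neq_ltn ltn_ord orbT.
  have lik : i < k by rewrite ltn_neqAle nik -ltnS ltn_ord.
  by apply/eqP/eqP => [[->]|ij]; rewrite ?inordK // ij inord_val.
(* If both are old, they are the distinct ends of [a]; if [prv] is new, equality would force
   [i.+1 = i.-1]. *)
have neq : prv != nxt.
  rewrite {1}/prv; case: ifP => [_|/negbT i0].
    rewrite /nxt; case: ifP => // _.
    by apply: contra (source_neq_target a) => /eqP[->].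
  by rewrite nxtE inordK // eq_sym neq_ltn ltnS leq_pred.
have -> : 2 = #|[set prv; nxt]| by rewrite cards2 neq.
congr #|pred_of_set _|; apply/setP=> -[w|[b j]]; rewrite !inE /=.
  rewrite /prv /nxt eqSS.
  by do 2!case: (_ == _ :> nat); rewrite ?andbT ?andbF.
case: (a =P b) => [<-|nab] /=; first by rewrite prvE nxtE orbC.
apply/esym/negbTE/negP; rewrite /prv /nxt.
by do 2!case: ifP => _; move=> /orP[]/eqP // [e]; case: nab.
Qed.

End Graph.

Theorem theorem2p5 (G : sgraph) (n m k : nat)
    (hconn : connected G) (hn : #|G| = n) (hm : #|edges G| = m)
    (hk : 1 <= k) :
  second_mult_zagreb (subdivision G k) = 4 ^ (k * m) * second_mult_zagreb G.
Proof.
(* The product over the sum type splits into old and new vertices; the degree lemmas need [k] as a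
   successor. *)
case: k hk => // k _; rewrite !second_mult_zagrebE big_sumType /= mulnC.
congr (_ * _); last by apply: eq_bigr => v _; rewrite degree_subdiv_old.
rewrite (eq_bigr (fun=> 4)); last by move=> [a i] _; rewrite degree_subdiv_new.
by rewrite prod_nat_const card_prod card_ord card_arc hm mulnC.
Qed.
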